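(* Let $X$ be a non-Lindelöf locally Lindelöf paracompact space, and let $\lambda$ be the ordinal with $\aleph_\lambda=\ell(X)$. Then there is a chain $$C_0(X)\subsetneqq H_0\subsetneqq H_1\subsetneqq\cdots\subsetneqq H_\lambda=C_B(X)$$ of closed ideals $H_\mu$ ($\mu\leq\lambda$ an ordinal) of $C_B(X)$, with $H_\mu\subsetneqq H_\kappa$ whenever $\mu<\kappa\leq\lambda$, such that for each $\mu<\lambda$ the ideal $H_\mu$ is isometrically isomorphic (as a normed algebra) to $$C_0(Y_\mu)=C_{00}(Y_\mu),$$ where $Y_\mu$ is a locally compact countably compact space which contains $X$ densely.
   Context: Paracompact spaces and locally compact spaces are Hausdorff. $X$ is locally Lindelöf if every point of $X$ has a Lindelöf neighborhood in $X$. The Lindelöf number of $X$ is $$\ell(X)=\min\{\mathfrak{n}:\text{any open cover of }X\text{ has a subcover of cardinality}\leq\mathfrak{n}\}+\aleph_0.$$ $C_B(X)$ is the normed algebra of continuous bounded $f:X\to\mathbb{C}$ with the supremum norm. $C_{00}(X)$ is the set of $f\in C_B(X)$ whose support $\mathrm{cl}_X\{x:f(x)\neq0\}$ is compact, and $C_0(X)$ is the set of $f\in C_B(X)$ such that $|f|^{-1}([1/n,\infty))$ is compact for each positive integer $n$. A space is countably compact if every countable open cover has a finite subcover. *)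

(* Defs.v *)
(* Complex numbers are R[i] for R : realType, with the topology of the normed
   module (R[i])^o. *)
From HB Require Import structures.
From mathcomp Require Import all_boot all_order all_algebra complex.
From mathcomp Require Import all_classical all_reals all_analysis.
Set Implicit Arguments.
Unset Strict Implicit.
Unset Printing Implicit Defensive.
Import Order.TTheory GRing.Theory Num.Theory.
Import numFieldNormedType.Exports.
Local Open Scope classical_set_scope.
Local Open Scope card_scope.
Local Open Scope ring_scope.

Definition open_cover (X : topologicalType) (A : set X) (C : set (set X)) :=
  C `<=` open /\ A `<=` \bigcup_(U in C) U.

Definition lindelof (X : topologicalType) (A : set X) :=
  forall C, open_cover A C ->
    exists2 D, D `<=` C & countable D /\ A `<=` \bigcup_(U in D) U.

Definition locally_lindelof (X : topologicalType) :=
  forall x : X, exists2 N, nbhs x N & lindelof N.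

Definition countably_compact (X : topologicalType) :=
  forall C : set (set X), open_cover [set: X] C -> countable C ->
    exists2 D, D `<=` C & finite_set D /\ [set: X] `<=` \bigcup_(U in D) U.

Definition locally_finite (X : topologicalType) (D : set (set X)) :=
  forall x : X, exists2 N, nbhs x N &
    finite_set [set U | D U /\ U `&` N !=set0].

(* Paracompact spaces are Hausdorff by convention. *)
Definition paracompact (X : topologicalType) :=
  hausdorff_space X /\
  forall C, open_cover [set: X] C ->
    exists D, [/\ open_cover [set: X] D,
                  forall V, D V -> exists2 U, C U & V `<=` U
                & locally_finite D].

(* A cardinal number is given by a type of that cardinality. *)
Definition card_lt (T U : Type) :=
  [set: T] #<= [set: U] /\ ~ ([set: U] #<= [set: T]).

Definition least_cardinal (P : Type -> Prop) (K : Type) :=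
  P K /\ forall B, P B -> [set: K] #<= [set: B].

Definition subcovers_bounded_by (X : topologicalType) (N : Type) :=
  forall C, open_cover [set: X] C ->
    exists2 D, D `<=` C & [set: X] `<=` \bigcup_(U in D) U /\
                          D #<= [set: N].

(* The disjoint sum N + nat represents the cardinal sum with aleph_0. *)
Definition is_lindelof_number (X : topologicalType) (K : Type) :=
  exists2 N : Type, least_cardinal (subcovers_bounded_by X) N &
                    [set: K] #= [set: (N + nat)%type].

(* Ordinals are positions in a well-ordered set: a well-ordered L with least
   element \bot and greatest element \top is the set of all ordinals mu <= lambda,
   where \bot is 0 and \top is lambda.  The sequence (aleph_mu)_(mu <= lambda) is
   determined by recursion: aleph_mu is the least infinite cardinal above every
   aleph_nu with nu < mu. *)
Definition is_aleph_sequence d (L : tbOrderType d) (aleph : L -> Type) :=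
  forall mu : L,
    least_cardinal
      (fun B : Type => infinite_set [set: B] /\
         forall nu : L, (nu < mu)%O -> card_lt (aleph nu) B)
      (aleph mu).

(* X is identified with a dense subspace of Y through e. *)
Definition dense_embedding (X Y : topologicalType) (e : X -> Y) :=
  [/\ injective e,
      forall U : set X, open U <-> exists2 V : set Y, open V & e @^-1` V = U
    & dense (range e)].

Section FunctionAlgebras.
Variables (R : realType) (X : topologicalType).
Implicit Types (f g : X -> R[i]^o) (H : set (X -> R[i]^o)).

(* Normc.normc is the R-valued modulus on R[i]. *)
Definition sup_norm f : R := sup (range (fun x => Normc.normc (f x))).

Definition CB : set (X -> R[i]^o) :=
  [set f : X -> R[i]^o | continuous f /\ exists M : R, forall x, Normc.normc (f x) <= M].

Definition C00 : set (X -> R[i]^o) :=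
  [set f : X -> R[i]^o | CB f /\ compact (closure [set x | f x != 0])].

Definition C0 : set (X -> R[i]^o) :=
  [set f : X -> R[i]^o | CB f /\ forall n : nat, (0 < n)%N ->
                     compact [set x | n%:R^-1 <= Normc.normc (f x)]].

Definition CB_ideal H :=
  [/\ H `<=` CB, H (cst 0),
      forall f g, H f -> H g -> H (f \+ g)
    & forall f g, CB f -> H g -> H (f \* g)].

Definition CB_closed H :=
  forall f, CB f ->
    (forall e : R, 0 < e -> exists2 g, H g & sup_norm (f \- g) < e) -> H f.

Definition closed_ideal H := CB_ideal H /\ CB_closed H.

End FunctionAlgebras.
Arguments CB : clear implicits.
Arguments C00 : clear implicits.
Arguments C0 : clear implicits.

Definition isometrically_isomorphic (R : realType) (X Y : topologicalType)
    (A : set (X -> R[i]^o)) (B : set (Y -> R[i]^o)) :=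
  exists phi : (X -> R[i]^o) -> (Y -> R[i]^o),
    [/\ set_bij A B phi,
        forall f g, A f -> A g -> phi (f \+ g) = phi f \+ phi g,
        forall (c : R[i]) f, A f -> phi (c \*o f) = c \*o phi f,
        forall f g, A f -> A g -> phi (f \* g) = phi f \* phi g
      & forall f, A f -> sup_norm (phi f) = sup_norm f].

(* Main.v *)
(** A locally Lindelof paracompact space [X] splits into a disjoint family [P] of
    nonempty clopen Lindelof pieces; when [X] is not Lindelof, the cardinality
    of [P] is the Lindelof number of [X].  Let [H_mu] be the ideal of bounded
    continuous functions supported in a union of at most [aleph_mu] pieces.
    Since a countable union of families of size at most [aleph_mu] again has
    size at most [aleph_mu], [H_mu] is closed, and indicator functions of unions
    of pieces separate the different [H_mu].  [Y_mu] is the union, over the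
    families [J] of at most [aleph_mu] pieces, of the closures of [\bigcup J] in
    the Stone-Cech compactification of [X]: these closures are compact and open,
    every countable subset of [Y_mu] lies in one of them, and restriction to [X]
    identifies [C_0(Y_mu)] with [H_mu]. *)
Require Import Defs.
From HB Require Import structures.
From mathcomp Require Import all_boot all_order all_algebra complex finmap.
From mathcomp Require Import all_classical all_reals all_analysis.
Import Order.TTheory GRing.Theory Num.Theory.
Import numFieldNormedType.Exports.
Local Open Scope classical_set_scope.
Local Open Scope ring_scope.
Set Implicit Arguments.
Unset Strict Implicit.
Unset Printing Implicit Defensive.

(** * Cardinality of countable unions *)

Local Open Scope card_scope.

Lemma card_le_funP (T : Type) (U : pointedType) (A : set T) (B : set U) :
  A #<= B <-> exists2 f : T -> U, set_fun A B f & set_inj A f.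
Proof. by split=> [/pcard_leP/injfunPex|/injfunPex H]; last apply/pcard_leP. Qed.

(** A point of the union is coded by a chosen index of a set containing it, paired with its value
    under the injection of that set into [B]. Equal codes share the index, so a single injection
    separates the points. *)
Lemma card_le_bigcup (I T U : Type) (D : set I) (F : I -> set T) (B : set U) :
  (forall i, D i -> F i #<= B) -> \bigcup_(i in D) F i #<= D `*` B.
Proof.
move=> FB.
elim/Pchoice: I => I in D F FB *.
have [F0|/set0P[x0 [i0 Di0 Fx0]]] := eqVneq (\bigcup_(i in D) F i) set0.
  by rewrite F0; exact: card_ge0.
elim/Ppointed: U => U in B FB *.
  by have := FB _ Di0; rewrite emptyE => /eqP F0; move: Fx0; rewrite F0.
pose I' := isPointed.Build I i0; pose IP : pointedType := HB.pack I I'.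
have {FB}/choice[f fP] : forall i, exists f : T -> U,
    D i -> set_fun (F i) B f /\ set_inj (F i) f.
  move=> i; have [/FB/card_le_funP[f ? ?]|nDi] := pselect (D i); last by exists point.
  by exists f.
have {x0 Fx0}/choice[c cP] : forall x, exists i,
    (\bigcup_(i in D) F i) x -> D i /\ F i x.
  by move=> x; have [[i Di Fx]|nx] := pselect ((\bigcup_(i in D) F i) x);
    [exists i|exists i0].
apply/(@card_le_funP _ (IP * U)%type); exists (fun x => (c x, f (c x) x)).
  by move=> x Dx; have [Dc Fc] := cP x Dx; split=> //=; apply: (fP _ Dc).1.
move=> x y; rewrite !inE => Dx Dy [cxy].
have [Dc Fx] := cP x Dx; have [_ Fy] := cP y Dy; move: Fy; rewrite -cxy => Fy.
by apply: (fP _ Dc).2; rewrite inE.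
Qed.

(* A maximal disjoint family of countably infinite subsets covers [A] up to a
   finite set; this splits [A] into countable pieces, each of which has room
   for countably many copies of itself. *)
Lemma infinite_card_leX_nat (T : Type) (A : set T) : infinite_set A ->
  A `*` [set: nat] #<= A.
Proof.
move=> infA; have [a0 Aa0] := infinite_setN0 infA.
elim/Pchoice: T => T in A infA a0 Aa0 *.
pose T' := isPointed.Build T a0; pose TP : pointedType := HB.pack T T'.
change (@card_le (TP * nat) TP (A `*` [set: nat]) A).
pose D : set (set TP) := [set S | S `<=` A /\ infinite_set S /\ countable S].
have sub_inf (B : set TP) : B `<=` A -> infinite_set B -> exists2 S, D S & S `<=` B.
  move=> BA /infiniteP/card_le_funP[f fB fI].
  exists (range f); last by move=> _ [n _ <-]; exact: fB.
  split; first by move=> _ [n _ <-]; exact/BA/fB.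
  have /card_eqPle[le1 le2] : range f #= [set: nat] by apply: inj_card_eq.
  by split=> //; apply/infiniteP.
have [E [ED /trivIsetP Etriv Emax]] := ex_maximal_disjoint_subcollection (@id (set TP)) D.
pose F := A `\` \bigcup_(S in E) S.
(* Otherwise a countably infinite subset of [F] could be added to [E], against maximality. *)
have finF : finite_set F.
  apply: contrapT => infF; have [S DS SF] := sub_inf F (@subDsetl _ _ _) infF.
  have S0 : S !=set0 by apply: infinite_setN0; case: DS => _ [].
  have nES : ~ E S by case: S0 => x Sx ES; case: (SF _ Sx) => _; apply; exists S.
  apply: (Emax (S |` E)).
  - split; first by move=> B EB; right.
    by move=> /(_ S (or_introl erefl)).
  - by move=> B [->//|/ED].
  - apply/trivIsetP => B C [->|EB] [->|EC]; rewrite ?eqxx// => BC.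
    + by rewrite -subset0 => x [/= /SF [_ nE] Cx]; apply: nE; exists C.
    + by rewrite -subset0 => x [/= Bx /SF [_ nE]]; apply: nE; exists B.
    + exact: Etriv.
have [S0 ES0] : exists S, E S.
  apply: contrapT => nE; apply: infA; apply: sub_finite_set finF => x Ax; split=> //.
  by case=> S ES; case: nE; exists S.
(* [c x] is the member of [E] containing [x]; the finitely many leftover points are all assigned to
   [S0]. *)
have {}/choice[c cP] : forall x, exists S, A x -> E S /\ (S x \/ (F x /\ S = S0)).
  move=> x; have [[S ES Sx]|nx] := pselect ((\bigcup_(S in E) S) x).
    by exists S => _; split=> //; left.
  by exists S0 => Ax; split=> //; right.
have {}/choice[g gP] : forall S, exists g : TP * nat -> TP, E S ->
    set_fun ((S `|` F) `*` [set: nat]) S g /\ set_inj ((S `|` F) `*` [set: nat]) g.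
  move=> S; have [/ED[_ [infS cS]]|nES] := pselect (E S); last by exists (fun=> a0).
  have : (S `|` F) `*` [set: nat] #<= S.
    have /infiniteP := infS; apply: card_le_trans; apply: countableX => //.
    rewrite -bigcup2inE; apply: bigcup_countable => // -[|[|i]] _ //.
    exact: finite_set_countable.
  by move=> /card_le_funP[g ? ?]; exists g.
apply/card_le_funP; exists (fun z => g (c z.1) z); first last.
  move=> [x m] [y n]; rewrite !inE => -[/= Ax _] [/= Ay _] gxy.
  have [Ex cx] := cP _ Ax; have [Ey cy] := cP _ Ay.
  have in_piece z k : c z z \/ (F z /\ c z = S0) ->
      ((c z `|` F) `*` [set: nat]) (z, k).
    by move=> [cz|[Fz _]]; split=> //; [left|right].
  have cxy : c x = c y.
    apply/eqP; apply/negP => /negP /(Etriv _ _ Ex Ey); apply/eqP/set0P.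
    exists (g (c x) (x, m)); split; first exact/(gP _ Ex).1/in_piece.
    by rewrite gxy; exact/(gP _ Ey).1/in_piece.
  apply: (gP _ Ex).2 => //; rewrite ?inE; first exact: in_piece.
    by rewrite cxy; exact: in_piece.
  by rewrite gxy cxy.
move=> [x m] [/= Ax _]; have [Ex cx] := cP _ Ax.
apply: (ED _ Ex).1; apply: (gP _ Ex).1.
by case: cx => [cz|[Fz _]]; split=> //; [left|right].
Qed.

(** Counting [D] by [nat] injects the union into [B * nat], which is no larger than [B]. This is
    what makes small families stable under countable unions. *)
Lemma card_le_bigcup_countable_index (I T U : Type) (D : set I) (F : I -> set T)
    (B : set U) : countable D -> infinite_set B ->
  (forall i, D i -> F i #<= B) -> \bigcup_(i in D) F i #<= B.
Proof.
move=> /countable_injP[g gI] infB FB.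
apply: card_le_trans (card_le_bigcup FB) _.
apply: card_le_trans _ (infinite_card_leX_nat infB).
elim/Ppointed: U => U in B infB FB *.
  by case: infB; rewrite emptyE; exact: finite_set0.
apply/(@card_le_funP _ (U * nat)%type); exists (fun z => (z.2, g z.1)).
  by move=> z [].
move=> [i b] [j b']; rewrite !inE => -[/= Di _] [/= Dj _] [-> /gI ->] //;
  by rewrite inE.
Qed.

Lemma card_le_bigcup_countable (I T : Type) (D : set I) (F : I -> set T) :
  infinite_set D -> (forall i, D i -> countable (F i)) ->
  \bigcup_(i in D) F i #<= D.
Proof.
move=> infD /card_le_bigcup le; apply: card_le_trans le _.
exact: infinite_card_leX_nat.
Qed.

Lemma card_leU (T U : Type) (A B : set T) (C : set U) : infinite_set C ->
  A #<= C -> B #<= C -> A `|` B #<= C.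
Proof.
move=> infC AC BC; rewrite -bigcup2inE; apply: card_le_bigcup_countable_index => //.
by move=> [|[|i]].
Qed.

(** * Paracompact spaces *)

Lemma hausdorff_closed_set1 (T : topologicalType) (x : T) :
  hausdorff_space T -> closed [set x].
Proof. by move=> /hausdorff_accessible/accessible_closed_set1. Qed.

(** Only finitely many members meet a suitable neighborhood of [b], and the union of their closures
    is closed; removing it leaves a neighborhood of [b] that misses every member. *)
Lemma closure_locally_finite (X : topologicalType) (D : set (set X)) (b : X) :
  locally_finite D -> (forall V, D V -> ~ closure V b) ->
  ~ closure (\bigcup_(V in D) V) b.
Proof.
move=> Dfin Db clb; have [N Nb finN] := Dfin b.
pose DN := [set U | D U /\ U `&` N !=set0].
have /(filterI Nb)/clb : nbhs b (~` \bigcup_(V in DN) closure V).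
  apply: open_nbhs_nbhs; split; last by move=> [V [DV _]]; exact: Db.
  by apply/closed_openC/closed_bigcup => // V _; exact: closed_closure.
move=> [x [[V DV Vx] [Nx]]]; apply; exists V; last exact: subset_closure.
by split=> //; exists x.
Qed.

Section Paracompact.
Variable X : topologicalType.
Hypothesis Xpara : paracompact X.

(** In a locally finite refinement, a member meeting [A] does not lie in the complement of [A], so
    its closure misses [B]; local finiteness passes this on to the closure of the union of such
    members. A one-point [B] gives regularity, and then a closed [B] gives normality. *)
Lemma paracompact_separation (A B : set X) : closed A ->
  (forall a, A a -> exists2 U, open_nbhs a U & closure U `&` B = set0) ->
  exists W, [/\ open W, A `<=` W & closure W `&` B = set0].
Proof.
move=> clA sepA.
pose C : set (set X) := [set U | open U /\ (U `<=` ~` A \/ closure U `&` B = set0)].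
have [|D [[Dop Dcov] Dref Dfin]] := Xpara.2 C.
  split=> [U []//|x _]; have [/sepA[U [oU Ux] UB]|nAx] := pselect (A x).
    by exists U => //; split=> //; right.
  by exists (~` A) => //; split; [exact: closed_openC|left].
pose E := [set V | D V /\ V `&` A !=set0].
exists (\bigcup_(V in E) V); split.
- by apply: bigcup_open => V [/Dop].
- move=> x Ax; have [V DV Vx] := Dcov x I.
  by exists V => //; split=> //; exists x.
- rewrite -subset0 => b [clb Bb]; move: clb; apply: closure_locally_finite.
    move=> x; have [N Nx finN] := Dfin x; exists N => //.
    by apply: sub_finite_set finN => V [[]].
  move=> V [DV [a [Va Aa]]] Vb; have [U [oU CU] VU] := Dref V DV.
  case: CU => [UA|UB]; first exact: UA (VU _ Va) Aa.
  by move: UB; rewrite -subset0 => /(_ b); apply; split=> //; exact: closureS Vb.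
Qed.

Lemma paracompact_normal (R : realType) : normal_space X.
Proof.
have cl1 (x : X) : closed [set x] by exact/hausdorff_closed_set1/Xpara.1.
have reg (A : set X) (b : X) : closed A -> ~ A b ->
    exists W, [/\ open W, A `<=` W & closure W `&` [set b] = set0].
  move=> clA nAb; apply: paracompact_separation => // a Aa.
  have ab : a != b by apply/eqP => ab; apply: nAb; rewrite -ab.
  have := Xpara.1; rewrite open_hausdorff => /(_ a b ab)[[U V]].
  rewrite !inE => -[/= Ua Vb] [/= oU oV UV].
  exists U => //; rewrite -subset0 => x [Ux xb]; move: Ux; rewrite xb => /(_ V)[].
    exact: open_nbhs_nbhs.
  by move=> y; rewrite UV.
apply/(@normal_openP R) => A B clA clB AB0.
have [|W [oW AW WB]] := @paracompact_separation A B clA.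
  move=> a Aa.
  have nBa : ~ B a by move=> Ba; have : (A `&` B) a by []; rewrite AB0.
  have [W [oW BW Wa]] := reg B a clB nBa.
  (* The open set [W] contains [B] and is disjoint from this complement, so the closure of the
     complement misses [B]. *)
  exists (~` closure W).
    split; first exact/closed_openC/closed_closure.
    by move=> Wa'; have : (closure W `&` [set a]) a by []; rewrite Wa.
  rewrite -subset0 => b [+ Bb]; move=> /(_ W)[|x [+ Wx]].
    by apply: open_nbhs_nbhs; split=> //; exact: BW.
  by apply; exact: subset_closure.
exists W, (~` closure W); split=> //.
- exact/closed_openC/closed_closure.
- by move=> b Bb Wb; have : (closure W `&` B) b by []; rewrite WB.
- by rewrite -subset0 => x [Wx]; apply; exact: subset_closure.
Qed.

End Paracompact.

(** * Decomposition into clopen Lindelof pieces *)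

Section ClopenDecomposition.
Variable X : topologicalType.
Hypothesis Xpara : paracompact X.
Hypothesis Xlin : locally_lindelof X.

(** The last clause also yields closedness: the complement of a union of pieces is the union of the
    remaining ones. *)
Definition clopen_lindelof_partition (P : set (set X)) :=
  [/\ forall A, P A -> A !=set0 /\ lindelof A,
      forall A B, P A -> P B -> A `&` B !=set0 -> A = B,
      forall x, exists2 A, P A & A x
    & forall J, J `<=` P -> open (\bigcup_(A in J) A)].

(** These are the unions of classes of the relation of being linked by a finite chain of overlapping
    members of [D]. *)
Definition saturated (D : set (set X)) (S : set X) :=
  forall V, D V -> V `&` S !=set0 -> V `<=` S.

(* With [D] a locally finite open cover by sets lying in Lindelof sets, each
   member of [D] meets only countably many others, so the least saturated set
   around a point is a countable union of members of [D]; saturated sets are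
   closed under complement, so these least sets are the pieces. *)
Lemma clopen_lindelof_partition_exists :
  exists P, clopen_lindelof_partition P.
Proof.
pose C : set (set X) := [set U | open U /\ exists2 N, lindelof N & U `<=` N].
have [|D [[Dop Dcov] Dref Dfin]] := Xpara.2 C.
  split=> [U []//|x _]; have [N Nx LN] := Xlin x.
  exists N°; last exact: Nx.
  by split; [exact: open_interior|exists N => //; exact: interior_subset].
have satU (S : set X) : saturated D S -> open S.
  move=> Ssat; rewrite openE => x Sx; have [V DV Vx] := Dcov x I.
  rewrite /interior nbhsE; exists V; first by split=> //; exact: Dop.
  by apply: Ssat => //; exists x.
have satC (S : set X) : saturated D S -> saturated D (~` S).
  by move=> Ssat V DV [x [Vx nSx]] y Vy Sy; apply: nSx; apply: (Ssat V) => //; exists y.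
pose M x : set X := [set y | forall S, saturated D S -> S x -> S y].
have Mx x : M x x by move=> S _.
have Msat x : saturated D (M x).
  move=> V DV [y [Vy My]] z Vz S Ssat Sx; apply: (Ssat V) => //.
  by exists y; split=> //; exact: My.
(* If [x] were outside [M y], the complement of [M y] would be a saturated set containing [x], hence
   also [y]. *)
have Msym x y : M x y -> M y x.
  move=> Mxy; apply: contrapT => nMyx.
  by have [] := Mxy _ (satC _ (Msat y)) nMyx.
have Meq x y : M x y -> M x = M y.
  move=> Mxy; apply/seteqP; split=> z Mz S Ssat Sy; apply: Mz => //.
    exact: (Msym _ _ Mxy).
  exact: Mxy.
(* [V] lies in a Lindelof set, which is covered by countably many open sets each meeting finitely
   many members of [D]. *)
have Dcount V : D V -> countable [set W | D W /\ W `&` V !=set0].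
  move=> DV; have [U [_ [N LN UN]] VU] := Dref V DV.
  pose E : set (set X) := [set G | open G /\ finite_set [set W | D W /\ W `&` G !=set0]].
  have [|E' E'E [cE' NE']] := LN E.
    split=> [G []//|x Nx]; have [G Ox finO] := Dfin x; exists (G°) => //.
    split; first exact: open_interior.
    apply: sub_finite_set finO => W [DW [y [Wy Oy]]]; split=> //; exists y.
    by split=> //; exact: interior_subset.
  have cU : countable (\bigcup_(G in E') [set W | D W /\ W `&` G !=set0]).
    by apply: bigcup_countable => // G /E'E[_]; exact: finite_set_countable.
  apply: sub_countable cU; apply: subset_card_le => W [DW [x [Wx Vx]]].
  by have [G E'G Ox] := NE' _ (UN _ (VU _ Vx)); exists G => //; split=> //; exists x.
have Mlin x : lindelof (M x).
  have [V0 DV0 V0x] := Dcov x I.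
  (* [T n] collects the members of [D] reached from [V0] by chains of [n] overlaps; the union over
     all [n] is saturated, so it contains [M x]. *)
  pose fix T n := if n is n.+1 then \bigcup_(U in T n) [set W | D W /\ W `&` U !=set0]
                  else [set V0].
  have TD n : T n `<=` D by case: n => [|n] W => [->//|[U _ []]].
  have cT n : countable (T n).
    elim: n => [|n IHn]; first exact: countable1.
    by apply: bigcup_countable => // U /TD; exact: Dcount.
  have MT : M x `<=` \bigcup_(V in \bigcup_n T n) V.
    move=> y; apply; last by exists V0 => //; exists 0%N.
    move=> V DV [z [Vz [U [n _ TU] Uz]]] w Vw; exists V => //; exists n.+1 => //.
    by exists U => //; split=> //; exists z.
  move=> K [Kop MK].
  have {}/choice[F FP] : forall V, exists F : set (set X), D V ->
      [/\ F `<=` K, countable F & V `&` M x `<=` \bigcup_(U in F) U].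
    move=> V; have [DV|nDV] := pselect (D V); last by exists set0.
    have [U [_ [N LN UN]] VU] := Dref V DV.
    (* [K] covers only [M x], so the open complement of [M x] is added to cover [N]; it is discarded
       afterwards, as it contains no point of [M x]. *)
    have [|F FK [cF NF]] := LN (K `|` [set ~` M x]).
      split=> [G [/Kop//|->]|y _]; first by apply: satU; apply: satC; exact: Msat.
      have [/MK[G KO Oy]|nMy] := pselect (M x y); first by exists G => //; left.
      by exists (~` M x) => //; right.
    exists (F `&` K) => _; split; first exact: subIsetr.
      by apply: sub_countable cF; apply: subset_card_le; exact: subIsetl.
    move=> y [Vy My]; have [G FO Oy] := NF _ (UN _ (VU _ Vy)).
    exists G => //; split=> //; have [//|Oeq] := FK _ FO.
    by move: Oy; rewrite Oeq => /(_ My).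
  exists (\bigcup_(V in \bigcup_n T n) F V).
    by apply: bigcup_sub => V [n _ /TD /FP[]].
  split.
    apply: bigcup_countable; first by apply: bigcup_countable.
    by move=> V [n _ /TD /FP[]].
  move=> y My; have [V [n _ TV] Vy] := MT y My.
  have [_ _ /(_ y)[//|G FO Oy]] := FP _ (TD _ _ TV).
  by exists G => //; exists V => //; exists n.
exists (range M); split.
- by move=> _ [x _ <-]; split=> //; exists x.
- by move=> _ _ [x _ <-] [y _ <-] [z [/Meq -> /Meq ->]].
- by move=> x; exists (M x).
- by move=> J JP; apply: bigcup_open => A /JP[x _ <-]; by apply: satU; exact: Msat.
Qed.

Variable P : set (set X).
Hypothesis PP : clopen_lindelof_partition P.

Lemma partition_open A : P A -> open A.
Proof.
case: PP => _ _ _ P4 PA.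
by rewrite -[A](@bigcup_set1 _ _ id); apply: P4 => _ ->.
Qed.

Lemma partition_bigcupC J : J `<=` P ->
  ~` (\bigcup_(A in J) A) = \bigcup_(A in P `\` J) A.
Proof.
case: PP => P1 P2 P3 P4 JP; apply/seteqP; split=> x.
  by move=> nJ; have [A PA Ax] := P3 x; exists A => //; split=> // JA; apply: nJ; exists A.
move=> [A [PA nJA] Ax] [B JB Bx]; apply: nJA.
by rewrite (P2 A B) //; [exact: JP|exists x].
Qed.

Lemma partition_bigcup_closed J : J `<=` P -> closed (\bigcup_(A in J) A).
Proof.
move=> JP; rewrite -openC partition_bigcupC //.
by case: PP => _ _ _; apply; exact: subDsetl.
Qed.

Lemma partition_countable_subcovers C : open_cover [set: X] C ->
  exists F : set X -> set (set X), forall A, P A ->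
    [/\ F A `<=` C, countable (F A) & A `<=` \bigcup_(U in F A) U].
Proof.
case: PP => P1 _ _ _ [Cop Ccov].
suff /choice[F FP] : forall A, exists FA : set (set X), P A ->
    [/\ FA `<=` C, countable FA & A `<=` \bigcup_(U in FA) U] by exists F.
move=> A; have [/P1[_ LA]|nPA] := pselect (P A); last by exists set0.
have [|F FC [cF AF]] := LA C; last by exists F.
by split=> // x _; exact: Ccov.
Qed.

Lemma subcovers_bounded_by_partition : infinite_set P ->
  subcovers_bounded_by X P.
Proof.
case: PP => _ _ P3 _ infP C /partition_countable_subcovers[F FP].
exists (\bigcup_(A in P) F A); first by apply: bigcup_sub => A /FP[].
split.
  move=> x _; have [A PA Ax] := P3 x; have [_ _ /(_ x Ax)[U FU Ux]] := FP A PA.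
  by exists U => //; exists A.
apply: (@card_le_trans _ _ _ P); last by have /card_eqPle[] := card_setT P.
by apply: card_le_bigcup_countable => // A /FP[].
Qed.

Hypothesis X_nonlindelof : ~ lindelof [set: X].

Lemma partition_uncountable : ~ countable P.
Proof.
case: PP => _ _ P3 _ cP; apply: X_nonlindelof.
move=> C /partition_countable_subcovers[F FP].
exists (\bigcup_(A in P) F A); first by apply: bigcup_sub => A /FP[].
split; first by apply: bigcup_countable => // A /FP[].
move=> x _; have [A PA Ax] := P3 x; have [_ _ /(_ x Ax)[U FU Ux]] := FP A PA.
by exists U => //; exists A.
Qed.

Lemma partition_infinite : infinite_set P.
Proof. by move=> /finite_set_countable; exact: partition_uncountable. Qed.

(** Being disjoint and nonempty, the pieces form an open cover whose only subcover is [P] itself, so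
    [P] is at most [N]. Conversely, countably many sets per piece suffice for any cover, so [N] is
    at most [P]. As [P] is infinite, the summand [nat] is absorbed. *)
Lemma partition_card_eq (K : Type) : is_lindelof_number X K -> P #= [set: K].
Proof.
case: PP => P1 P2 P3 P4 [N [Nbd Nmin] KN].
have infP := partition_infinite.
have PN : P #<= [set: N].
  have [|D DP [Dcov DN]] := Nbd P.
    by split=> [A /partition_open//|x _]; exact: P3.
  apply: card_le_trans DN; apply: subset_card_le => A PA.
  have [[x Ax] _] := P1 A PA; have [B DB Bx] := Dcov x I.
  by rewrite (P2 A B) //; [exact: DP|exists x].
have NP : [set: N] #<= P.
  have := Nmin _ (subcovers_bounded_by_partition infP).
  move=> /card_le_trans; apply; by have /card_eqPle[] := card_setT P.
suff : P #= [set: (N + nat)%type] by move=> /card_eq_trans; apply; rewrite card_eq_sym.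
apply/card_eqPle; split.
  apply: (card_le_trans PN).
  have /card_eqPle[_ /card_le_trans] : @inl N nat @` setT #= [set: N].
    by apply: inj_card_eq => x y _ _ [].
  by apply; exact: card_leT.
have -> : [set: (N + nat)%type] = inl @` setT `|` inr @` setT.
  by apply/seteqP; split=> // -[n|n] _; [left|right]; exists n.
apply: card_leU => //; first exact: card_le_trans (card_image_le _ _) NP.
by apply: card_le_trans (card_image_le _ _) _; exact/infiniteP.
Qed.
End ClopenDecomposition.

(** * Bounded complex-valued functions *)

(** Applied to the modulus of [f x], this makes the set where [f] is nonzero a countable union of
    level sets. *)
Lemma exists_invS_le (R : archiRealFieldType) (r : R) : 0 < r ->
  exists n : nat, n.+1%:R^-1 <= r.
Proof.
move=> r0; exists (Num.bound r^-1); rewrite invf_ple ?posrE //; apply: ltW.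
by apply: lt_trans (archi_boundP _) _; rewrite ?ltr_nat // invr_ge0 ltW.
Qed.

Section ComplexValuedFunctions.
Variables (R : realType) (X : topologicalType).
Implicit Types (f g : X -> R[i]^o) (z w : R[i]).

Local Notation normc := (@Normc.normc R).

(** The norm of [R[i]] takes values in [R[i]] and is [normc] followed by the embedding of [R];
    [change] exposes it here and below. *)
Lemma normc_ge0 z : 0 <= normc z.
Proof. by rewrite -lecR; change ((0 : R[i]) <= `|z|). Qed.

Lemma normcD_le z w : normc (z + w) <= normc z + normc w.
Proof. by rewrite -lecR rmorphD; change (`|z + w| <= `|z| + `|w|); exact: ler_normD. Qed.

Lemma normcB_sym z w : normc (z - w) = normc (w - z).
Proof. by apply: (@complexI R); change (`|z - w| = `|w - z|); exact: distrC. Qed.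

Lemma normc_lerB z w : `|normc z - normc w| <= normc (z - w).
Proof.
have tri (a b : R[i]) : normc a - normc b <= normc (a - b).
  by rewrite lerBlDr -{1}[a](subrK b) normcD_le.
rewrite ler_norml tri andbT lerNl opprB normcB_sym; exact: tri.
Qed.

Lemma normc_eq0 z : (normc z == 0) = (z == 0).
Proof.
apply/eqP/eqP => [/Normc.eq0_normc//|->]; exact: Normc.normc0.
Qed.

Lemma normc_gt0 z : (0 < normc z) = (z != 0).
Proof. by rewrite lt_def normc_ge0 andbT normc_eq0. Qed.

Lemma normcR (a : R) : normc a%:C%C = `|a|.
Proof. by rewrite /= expr0n addr0 sqrtr_sqr. Qed.

Lemma Re_normc_le z : `|complex.Re z| <= normc z.
Proof. by rewrite -lecR; change (`|complex.Re z|%:C%C <= `|z|); exact: normc_ge_Re. Qed.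

Lemma Im_normc_le z : `|complex.Im z| <= normc z.
Proof.
case: z => a b /=; rewrite -[ `|b|]ger0_norm // -sqrtr_sqr ler_wsqrtr //.
by rewrite real_normK ?num_real // lerDr sqr_ge0.
Qed.

(** The metric criterion quantifies over radii in [R[i]]; a positive element of [R[i]] has imaginary
    part zero, so real radii suffice. *)
Lemma continuous_normcP f x :
  {for x, continuous f} <->
  forall e : R, 0 < e -> \forall y \near x, normc (f x - f y) < e.
Proof.
split=> [/cvgrPdist_lt fx e e0|fx].
  have /fx : (0 : R[i]) < e%:C%C by rewrite ltcR.
  by apply: filterS => y; rewrite -[ `|_|]/((normc _)%:C%C) ltcR.
apply/cvgrPdist_lt => -[e e']; rewrite ltcE /= => /andP[/eqP -> /fx].
by apply: filterS => y; rewrite -ltcR.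
Qed.

Lemma lipschitz_continuous (h : R[i] -> R) f :
  (forall z w, `|h z - h w| <= normc (z - w)) -> continuous f ->
  continuous (h \o f).
Proof.
move=> hL fc x; apply/cvgrPdist_lt => e e0.
have /continuous_normcP/(_ e e0) := fc x.
by apply: filterS => y; exact: (le_lt_trans (hL _ _)).
Qed.

Lemma continuous_normc f : continuous f -> continuous (fun x => normc (f x)).
Proof. by apply: lipschitz_continuous; exact: normc_lerB. Qed.

Lemma continuous_Re f : continuous f -> continuous (fun x => complex.Re (f x)).
Proof.
apply: lipschitz_continuous => z w; apply: le_trans (Re_normc_le _).
by case: z => ? ?; case: w.
Qed.

Lemma continuous_Im f : continuous f -> continuous (fun x => complex.Im (f x)).
Proof.
apply: lipschitz_continuous => z w; apply: le_trans (Im_normc_le _).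
by case: z => ? ?; case: w.
Qed.

Lemma normc_le_ReIm (a b : R) : normc (a +i* b)%C <= `|a| + `|b|.
Proof.
rewrite -[leRHS]ger0_norm ?addr_ge0 // -sqrtr_sqr ler_wsqrtr //.
by rewrite sqrrD !real_normK ?num_real // lerD2r lerDl mulrn_wge0 // mulr_ge0.
Qed.

Lemma continuous_complex (u v : X -> R) : continuous u -> continuous v ->
  continuous (fun x => (u x +i* v x)%C : R[i]^o).
Proof.
move=> uc vc x; apply/continuous_normcP => e e0.
have e20 : 0 < e / 2 by rewrite divr_gt0.
have /cvgrPdist_lt/(_ _ e20) ux := uc x; have /cvgrPdist_lt/(_ _ e20) vx := vc x.
near=> y; rewrite (splitr e).
apply: (le_lt_trans (normc_le_ReIm (u x - u y) (v x - v y))).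
by apply: ltrD; near: y.
Unshelve. all: by end_near. Qed.

Lemma CB_cst z : CB R X (cst z).
Proof. by split=> [x|]; [exact: cvg_cst|exists (normc z)]. Qed.

Lemma CB_add f g : CB R X f -> CB R X g -> CB R X (f \+ g).
Proof.
move=> [fc [M fM]] [gc [N gN]]; split=> [x|].
  by apply: (@continuousD _ R[i]^o); [exact: fc|exact: gc].
by exists (M + N) => x; rewrite (le_trans (normcD_le _ _)) ?lerD.
Qed.

Lemma CB_mul f g : CB R X f -> CB R X g -> CB R X (f \* g).
Proof.
move=> [fc [M fM]] [gc [N gN]]; split=> [x|].
  by apply: (@continuousM R[i]); [exact: fc|exact: gc].
by exists (M * N) => x; rewrite Normc.normcM ler_pM ?normc_ge0.
Qed.

Lemma CB_scale z f : CB R X f -> CB R X (z \*o f).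
Proof. by move=> /(CB_mul (CB_cst z)). Qed.

Lemma CB_sub f g : CB R X f -> CB R X g -> CB R X (f \- g).
Proof.
move=> fB gB; have -> : f \- g = f \+ (-1 \*o g).
  by apply/funext => x /=; rewrite mulN1r.
exact/CB_add/CB_scale.
Qed.

Lemma sup_norm_ge f x : CB R X f -> normc (f x) <= sup_norm f.
Proof.
move=> [_ [M fM]]; apply: ub_le_sup; last by exists x.
by exists M => _ [y _ <-].
Qed.

Lemma sup_norm_le f (x0 : X) s : (forall x, normc (f x) <= s) -> sup_norm f <= s.
Proof.
move=> fs; apply: ge_sup; first by exists (normc (f x0)); exists x0.
by move=> _ [x _ <-].
Qed.

Lemma closed_normc_ge f (r : R) : continuous f -> closed [set x | r <= normc (f x)].
Proof.
move=> fc; have -> : [set x | r <= normc (f x)] = (fun x => normc (f x)) @^-1` [set s | r <= s].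
  by [].
by apply: closed_comp; [move=> y _; exact: continuous_normc|exact: closed_ge].
Qed.

Lemma closed_normc_le f (r : R) : continuous f -> closed [set x | normc (f x) <= r].
Proof.
move=> fc; have -> : [set x | normc (f x) <= r] = (fun x => normc (f x)) @^-1` [set s | s <= r].
  by [].
by apply: closed_comp; [move=> y _; exact: continuous_normc|exact: closed_le].
Qed.

Lemma CB_indicator (A : set X) : open A -> open (~` A) ->
  CB R X (fun x => (\1_A x : R)%:C%C).
Proof.
move=> oA oAC; split; last first.
  exists 1 => x; rewrite normcR; by rewrite indicE; case: (_ \in _); rewrite ?normr1 ?normr0.
move=> x; apply/continuous_normcP => e e0.
have [Ax|nAx] := pselect (A x).
  have : nbhs x A by exact: open_nbhs_nbhs.
  by apply: filterS => y Ay; rewrite !indicE !mem_set // subrr Normc.normc0.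
have : nbhs x (~` A) by exact: open_nbhs_nbhs.
by apply: filterS => y Ay; rewrite !indicE !memNset // subrr Normc.normc0.
Qed.

End ComplexValuedFunctions.

Lemma CB_comp (R : realType) (X Y : topologicalType) (e : X -> Y) (g : Y -> R[i]^o) :
  continuous e -> CB R Y g -> CB R X (g \o e).
Proof.
move=> ec [gc [M gM]]; split; last by exists M => x; exact: gM.
by move=> x; apply: continuous_comp; [exact: ec|exact: gc].
Qed.

(** Density is used in this form throughout: a closed condition on [Y] need only be checked on the
    image of [X]. *)
Lemma dense_closed_range (X Y : topologicalType) (e : X -> Y) (S : set Y) :
  dense (range e) -> closed S -> (forall x, S (e x)) -> forall y, S y.
Proof.
move=> de clS eS y; apply: contrapT => nSy.
have [|z [nSz [x _ exz]]] := de (~` S) _ (closed_openC clS); first by exists y.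
by apply: nSz; rewrite -exz.
Qed.

(** [compact_cover] is applied with a point of [S] as base point of [Y]; the empty [S] is treated
    apart. *)
Lemma compact_finite_subset_cover (Y : topologicalType) (S : set Y)
    (I : choiceType) (D : set I) (F : I -> set Y) :
  compact S -> (forall i, D i -> open (F i)) -> S `<=` cover D F ->
  finite_subset_cover D F S.
Proof.
move=> cS Fop SF; have [->|/set0P[y _]] := eqVneq S set0.
  by exists fset0%fset.
pose Y' := isPointed.Build Y y; pose YP : ptopologicalType := HB.pack Y Y'.
suff : @cover_compact YP S by apply.
by rewrite -compact_cover.
Qed.

(** * The ideals and their spectra *)
Section SmallSupport.
Variables (R : realType) (X : topologicalType) (P : set (set X)) (K : Type).
Hypothesis infK : infinite_set [set: K].
Implicit Types (f g : X -> R[i]^o) (J : set (set X)).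

Definition small_family J := J `<=` P /\ J #<= [set: K].

Definition small_support_ideal : set (X -> R[i]^o) :=
  [set f | CB R X f /\ exists2 J, small_family J &
                         [set x | f x != 0] `<=` \bigcup_(A in J) A].

Lemma small_family_bigcup (I : Type) (D : set I) (F : I -> set (set X)) :
  countable D -> (forall i, D i -> small_family (F i)) ->
  small_family (\bigcup_(i in D) F i).
Proof.
move=> cD FS; split; first by apply: bigcup_sub => i /FS[].
by apply: card_le_bigcup_countable_index => // i /FS[].
Qed.

Lemma small_support_closed_ideal : closed_ideal small_support_ideal.
Proof.
split; first split.
- by move=> f [].
- split; first exact: CB_cst.
  exists set0; last by move=> x; rewrite /= eqxx.
  by split; [exact: sub0set|exact: card_ge0].
- move=> f g [fB [J JS fJ]] [gB [J' J'S gJ']]; split; first exact: CB_add.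
  exists (\bigcup_(i in [set: bool]) (if i then J else J')).
    by apply: small_family_bigcup; [exact: countableP|case].
  move=> x /= fgx; have [fx0|/fJ[A JA Ax]] := eqVneq (f x) 0; last first.
    by exists A => //; exists true.
  have [|A JA Ax] := gJ' x; last by exists A => //; exists false.
  by apply: contra fgx => /eqP gx0; rewrite fx0 gx0 addr0.
- move=> f g fB [gB [J JS gJ]]; split; first exact: CB_mul.
  exists J => // x /= fgx; apply: gJ => /=.
  by apply: contra fgx => /eqP ->; rewrite mulr0.
move=> f fB fcl; split=> //.
have {fcl}/choice[g gP] : forall n, exists g,
    small_support_ideal g /\ sup_norm (f \- g) < n.+1%:R^-1.
  by move=> n; have [|g gI fg] := fcl n.+1%:R^-1; [rewrite invr_gt0|exists g].
(* Where the modulus of [f] is at least 1/(n+1), the approximant [g n] cannot vanish, being closer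
   to [f] than that. *)
have {gP}/choice[J JP] : forall n, exists J, small_family J /\
    forall x, n.+1%:R^-1 <= Normc.normc (f x) -> (\bigcup_(A in J) A) x.
  move=> n; have [[gB [J JS gJ]] fg] := gP n; exists J; split=> // x fx.
  apply: gJ; apply/eqP => gx0; move: fg; apply/negP; rewrite -leNgt.
  apply: le_trans fx _; have := @sup_norm_ge R X _ x (CB_sub fB gB).
  by rewrite /= gx0 subr0.
exists (\bigcup_n J n).
  by apply: small_family_bigcup => // n _; case: (JP n).
move=> x /=; rewrite -normc_gt0 => /exists_invS_le[n fn].
by have [_ /(_ x fn)[A JA Ax]] := JP n; exists A => //; exists n.
Qed.

End SmallSupport.

(** * Spaces covered by compact open blocks *)

Section BlockSpace.
Variables (R : realType) (X Y : topologicalType) (P : set (set X)) (K : Type).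
Hypothesis infK : infinite_set [set: K].
(** Under the hypotheses below, [B J] is the closure in [Y] of the image of the union of [J]: it is
    clopen, has that union as trace on [X], and [X] is dense. *)
Variables (e : X -> Y) (B : set (set X) -> set Y) (x0 : X).
Local Notation small := (small_family P K).
Hypothesis e_dense : dense_embedding e.
Hypothesis Y_T2 : hausdorff_space Y.
Hypothesis B_open : forall J, small J -> open (B J).
Hypothesis B_compact : forall J, small J -> compact (B J).
Hypothesis B_cover : forall y, exists2 J, small J & B J y.
Hypothesis B_trace : forall J x, small J -> B J (e x) <-> (\bigcup_(A in J) A) x.
Hypothesis extension :
  forall f : X -> R[i]^o, CB R X f -> exists2 g : Y -> R[i]^o, CB R Y g & g \o e = f.
Implicit Types (J : set (set X)).

Let B_closed J : small J -> closed (B J).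
Proof. by move=> JS; apply: compact_closed => //; exact: B_compact. Qed.

Let e_continuous : continuous e.
Proof.
case: e_dense => _ eop _; apply/continuousP => V oV; apply/eop.
by exists V.
Qed.

Let density (S : set Y) : closed S -> (forall x, S (e x)) -> forall y, S y.
Proof. by case: e_dense => _ _; exact: dense_closed_range. Qed.

(** As [B J] is open, its complement together with [B J'] is closed, and it contains the image of
    [X]. *)
Let B_subset J J' : small J -> small J' -> J `<=` J' -> B J `<=` B J'.
Proof.
move=> JS J'S JJ' y By.
have : (~` B J `|` B J') y; last by case.
move: y {By}; apply: density => [|x].
  by apply: closedU; [exact/open_closedC/B_open|exact: B_closed].
have [/B_trace [//|A JA Ax]|nB] := pselect (B J (e x)); last by left.
by right; apply/B_trace => //; exists A => //; exact: JJ'.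
Qed.

Let small_bigcup (I : Type) (D : set I) (F : I -> set (set X)) :
  countable D -> (forall i, D i -> small (F i)) -> small (\bigcup_(i in D) F i).
Proof. exact: small_family_bigcup. Qed.

Lemma block_locally_compact : locally_compact [set: Y].
Proof.
move=> y _; have [J JS By] := B_cover y; exists (B J).
  have : nbhs y (B J) by apply: open_nbhs_nbhs; split=> //; exact: B_open.
  by rewrite /within /=; apply: filterS.
by split; [exact: B_compact|exact: B_closed].
Qed.

(** If no finite subfamily of a countable [C] covers, choose a point missed by each. There are
    countably many finite subfamilies, so all chosen points lie in one block; a finite subcover of
    that compact block contradicts the choice made for it. *)
Lemma block_countably_compact : countably_compact Y.
Proof.
move=> C [Cop Ccov] cC; apply: contrapT => nfin.
pose Fin := [set D | D `<=` C /\ finite_set D].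
have {}/choice[y yP] : forall D, exists y, Fin D -> ~ (\bigcup_(U in D) U) y.
  move=> D; have [[DC finD]|nD] := pselect (Fin D); last by exists (e x0).
  have : ~ [set: Y] `<=` \bigcup_(U in D) U by move=> YD; apply: nfin; exists D.
  by move=> /existsNP[y /not_implyP[_ ny]]; exists y.
have {}/choice[J JP] : forall D, exists J, small J /\ B J (y D).
  by move=> D; have [J JS BJ] := B_cover (y D); exists J.
have Jsmall : small (\bigcup_(D in Fin) J D).
  by apply: small_bigcup => [|D _]; [exact: countable_finite_subset|case: (JP D)].
have [//||D' D'C BD'] := @compact_finite_subset_cover Y _ _ C id (B_compact Jsmall).
  by move=> z _; exact: Ccov.
have D'fin : Fin [set` D'].
  by split=> [U /D'C|]; [rewrite inE|exact: finite_fset].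
apply: (yP _ D'fin); apply: BD'; have [JS BJ] := JP [set` D'].
by apply: B_subset BJ => //; apply: bigcup_sup.
Qed.

Let compact_in_block (S : set Y) : compact S -> exists2 J, small J & S `<=` B J.
Proof.
move=> /(@compact_finite_subset_cover Y _ _ small B)/(_ B_open)[|D DS SD].
  by move=> y _; have [J JS By] := B_cover y; exists J.
have DS' J : [set` D] J -> small J by move=> /DS; rewrite inE.
have US : small (\bigcup_(J in [set` D]) J).
  by apply: small_bigcup => //; exact/finite_set_countable/finite_fset.
exists (\bigcup_(J in [set` D]) J) => // y /SD[J DJ]; apply: B_subset => //.
  exact: DS'.
exact: bigcup_sup.
Qed.

Let C0_support (g : Y -> R[i]^o) : C0 R Y g ->
  exists2 J, small J & [set y | g y != 0] `<=` B J.
Proof.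
move=> [gB gC].
have {}/choice[J JP] : forall n : nat, exists J, small J /\
    [set y | n.+1%:R^-1 <= Normc.normc (g y)] `<=` B J.
  by move=> n; have [J JS gJ] := compact_in_block (gC n.+1 isT); exists J.
have US : small (\bigcup_n J n) by apply: small_bigcup => // n _; case: (JP n).
exists (\bigcup_n J n) => // y /=; rewrite -normc_gt0 => /exists_invS_le[n gn].
have [JS gJ] := JP n; apply: (@B_subset (J n)) => //; first exact: bigcup_sup.
exact: gJ.
Qed.

(** Each level set of a [C0] function fits in a block, and countably many blocks fit in one; that
    block is closed, so it contains the support, and compact. *)
Lemma block_C0_eq_C00 : C0 R Y = C00 R Y.
Proof.
apply/seteqP; split=> g gC.
  split; first by case: gC.
  have [J JS gJ] := C0_support gC.
  apply: (subclosed_compact _ (B_compact JS)); first exact: closed_closure.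
  by rewrite [B J](closure_id _).1; [exact: closureS|exact: B_closed].
case: gC => gB gC; split=> // n n0; apply: (subclosed_compact _ gC).
  by apply: closed_normc_ge; case: gB.
move=> y /= gy; apply: subset_closure => /=; rewrite -normc_gt0.
by apply: lt_le_trans gy; rewrite invr_gt0 ltr0n.
Qed.

Let uniq_ext (g h : Y -> R[i]^o) : CB R Y g -> CB R Y h -> g \o e = h \o e -> g = h.
Proof.
move=> gB hB gh; apply/funext => y; apply/eqP; rewrite -subr_eq0 -normc_eq0.
rewrite eq_le normc_ge0 andbT; move: y; apply: density => [|x].
  by apply: (@closed_normc_le R Y (g \- h)); case: (CB_sub gB hB).
by have /(congr1 (fun f => f x)) /= -> := gh; rewrite /= subrr Normc.normc0.
Qed.

(** The map sends [f] to its continuous extension. Algebraic identities hold because both sides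
    extend the same function, and the norm is kept because a bound on the modulus is a closed
    condition. *)
Lemma block_isometrically_isomorphic :
  isometrically_isomorphic (small_support_ideal (R := R) P K) (C0 R Y).
Proof.
(* The default [cst 0] occurs only for [f] outside [CB]. *)
pose phi (f : X -> R[i]^o) : Y -> R[i]^o :=
  xget (cst 0) [set g | CB R Y g /\ g \o e = f].
have phiP f : CB R X f -> CB R Y (phi f) /\ phi f \o e = f.
  move=> /extension[g gB ge]; rewrite /phi; case: xgetP => [h _ //|].
  by move=> /(_ g) /not_andP[].
have phiB f : CB R X f -> CB R Y (phi f) by move=> /phiP[].
have phie f : CB R X f -> phi f \o e = f by move=> /phiP[].
have phiE f x : CB R X f -> phi f (e x) = f x.
  by move=> /phie fe; rewrite -[in RHS]fe.
have phi_uniq f g : CB R X f -> CB R Y g -> g \o e = f -> phi f = g.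
  by move=> fB gB ge; apply: uniq_ext => //; [exact: phiB|rewrite phie].
exists phi; split.
- split.
  + move=> f [fB [J JS fJ]]; have [gB ge] := phiP f fB; split=> // n n0.
    apply: (subclosed_compact _ (B_compact JS)).
      by apply: closed_normc_ge; case: gB.
    (* The zero set of [phi f], written as a sublevel set to make it visibly closed, covers [Y]
       together with [B J], since it does so on [X]. *)
    move=> y /= gy; have : ([set y | Normc.normc (phi f y) <= 0] `|` B J) y.
      move: y {gy}; apply: density => [|x].
        apply: closedU; last exact: B_closed.
        by apply: closed_normc_le; case: gB.
      have [fx0|/fJ Jx] := eqVneq (f x) 0; last by right; apply/B_trace.
      by left; rewrite /= phiE // fx0 Normc.normc0.
    by case=> //= /(le_trans gy); rewrite invr_le0 lern0 -leqn0 leqNgt n0.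
  + by move=> f g; rewrite !inE => -[/phie fe _] [/phie ge _] fg; rewrite -fe fg ge.
  + move=> g gC; have [J JS gJ] := C0_support gC; have gB := gC.1.
    exists (g \o e); last exact/phi_uniq/erefl/gB/CB_comp.
    split; first exact: CB_comp.
    by exists J => // x /= /gJ; move/B_trace; apply.
- move=> f g [fB _] [gB _]; apply: phi_uniq; [exact: CB_add|exact/CB_add/phiB/gB/phiB|].
  by apply/funext => x /=; rewrite !phiE.
- move=> c f [fB _]; apply: phi_uniq; [exact: CB_scale|exact/CB_scale/phiB|].
  by apply/funext => x /=; rewrite phiE.
- move=> f g [fB _] [gB _]; apply: phi_uniq; [exact: CB_mul|exact/CB_mul/phiB/gB/phiB|].
  by apply/funext => x /=; rewrite !phiE.
- move=> f [fB _]; apply/eqP; rewrite eq_le; apply/andP; split.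
    apply: (sup_norm_le (e x0)); apply: density => [|x].
      by apply: closed_normc_le; case: (phiB _ fB).
    by rewrite /= phiE //; exact: sup_norm_ge.
  apply: (sup_norm_le x0) => x; rewrite -phiE //.
  exact/sup_norm_ge/phiB.
Qed.

End BlockSpace.

(** * Subspaces *)

Section Subtype.
Variables (Z : topologicalType) (S : set Z).

Lemma hausdorff_set_type : hausdorff_space Z -> hausdorff_space S.
Proof.
move=> hZ x y xy; apply/val_inj/hZ => A B xA yB.
have vc : continuous (@set_val Z S) by exact: initial_continuous.
have [z [zA zB]] := xy _ _ (vc x A xA) (vc y B yB).
by exists (set_val z).
Qed.

(** The image filter under [set_val] clusters at a point of [A]; this point lies in [S], and open
    sets of [S] are traces of open sets of [Z]. *)
Lemma compact_set_type (A : set Z) : A `<=` S -> compact A ->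
  compact ((@set_val Z S) @^-1` A).
Proof.
move=> AS cA F FF FA.
have [|p [Ap pF]] := cA (@set_val Z S @ F) _; first exact: FA.
exists (SigSub (mem_set (AS _ Ap))); split=> // B C FB.
move=> [_ /= [[V oV <-] Vp VC]].
have GB : (@set_val Z S @ F) (set_val @` B).
  have sub : B `<=` set_val @^-1` (set_val @` B) by move=> y By; exists y.
  exact: (@filterS S F) sub FB.
have [_ [[y By <-] Vy]] := pF _ V GB (open_nbhs_nbhs (conj oV Vp)).
by exists y; split=> //; exact: VC.
Qed.

End Subtype.

(** * Construction of the block space in the Stone-Cech compactification *)

Section Compactification.
Variables (R : realType) (X : topologicalType) (P : set (set X)) (K : Type).
Hypothesis infK : infinite_set [set: K].
Hypothesis Xpara : paracompact X.
Hypothesis PP : clopen_lindelof_partition P.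
Local Notation small := (small_family P K).

(** These index the coordinates of a cube in which the closure of the image of [X] is its Stone-Cech
    compactification. *)
Definition unit_functions : set (X -> R) :=
  [set f : X -> R | continuous f /\ forall x, f x \in `[0, 1]].

Let unit_type : choiceType := set_type unit_functions.
(** The factors are the whole line; the compact unit cube enters as a subset, in [cube_compact]. *)
Let cube : topologicalType := prod_topology (fun _ : unit_type => R : topologicalType).
Let eval : X -> cube := fun x i => set_val i x.

Let unit_of (f : X -> R) : continuous f -> (forall x, f x \in `[0, 1]) ->
  exists i : unit_type, set_val i = f.
Proof. by move=> fc f01; have fU : unit_functions f by []; exists (SigSub (mem_set fU)). Qed.

Let coord_continuous (i : unit_type) : continuous (fun y : cube => y i).
Proof. exact: (@proj_continuous unit_type (fun=> R : topologicalType) i). Qed.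

(** By normality, a Urysohn function is 0 at [x] and 1 on [U]. *)
Let unit_separates : separate_points_from_closed (fun i : unit_type => set_val i : X -> R).
Proof.
move=> U x clU nUx.
have cl1 : closed [set x] by exact/hausdorff_closed_set1/Xpara.1.
have /(@normal_separatorP R) sepX := paracompact_normal Xpara R.
have [|f [fc f01 fx fU]] := (@uniform_separatorP _ R _ _).1 (sepX [set x] U cl1 clU _).
  by rewrite -subset0 => y [-> /nUx].
have [|i iE] := unit_of fc; first by move=> y; apply: f01; exists y.
exists i; rewrite iE => /(closureS fU).
rewrite -(closure_id _).1; last exact/hausdorff_closed_set1/Rhausdorff.
by rewrite (fx (f x)) /=; [move/eqP; rewrite eq_sym oner_eq0|exists x].
Qed.

Let cube_compact : compact [set y : cube | forall i, y i \in `[0, 1]].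
Proof.
have := @tychonoff unit_type (fun=> R : topologicalType) (fun=> [set` `[0, 1]]).
by apply=> i; exact: segment_compact.
Qed.

Let cube_hausdorff : hausdorff_space cube.
Proof.
apply: (@hausdorff_product unit_type (fun=> R : topologicalType)) => i.
exact: Rhausdorff.
Qed.

(** [Y] consists of the points of the compactification at which the indicator coordinate of some
    small union equals 1, and [B J] is the set where the coordinate of [J] does. Bounded functions
    extend because, after rescaling, their real and imaginary parts are coordinates. *)
Lemma block_space_exists : exists (Y : topologicalType) (e : X -> Y)
    (B : set (set X) -> set Y),
  [/\ dense_embedding e, hausdorff_space Y,
      forall J, small J ->
        [/\ open (B J), compact (B J) &
            forall x, B J (e x) <-> (\bigcup_(A in J) A) x],
      forall y, exists2 J, small J & B J y
    & forall f : X -> R[i]^o, CB R X f ->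
        exists2 g : Y -> R[i]^o, CB R Y g & g \o e = f].
Proof.
have eval_unit (i : unit_type) : continuous (set_val i : X -> R).
  by have [] := set_valP i.
have eval_cont := join_product_continuous unit_separates eval_unit.
have eval_inj : set_inj [set: X] eval.
  apply: (join_product_inj unit_separates).
  exact/hausdorff_accessible/Xpara.1.
have eval_open := join_product_initial unit_separates eval_unit eval_inj.
(* [chi J] is the coordinate given by the indicator of the union of [J]; for a family that is not
   small it is the zero function. *)
have /choice[chi chiP] : forall J, exists i : unit_type, small J ->
    forall x, set_val i x = \1_(\bigcup_(A in J) A) x.
  move=> J; have [JS|nJS] := pselect (small J); last first.
    have [||i _] := @unit_of (cst 0); last by exists i.
      by move=> x; exact: cvg_cst.
    by move=> x; rewrite in_itv /= lexx ler01.
  have [||i iE] := @unit_of (\1_(\bigcup_(A in J) A)).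
  - have : CB R X (fun x => (\1_(\bigcup_(A in J) A) x)%:C%C).
      apply: CB_indicator; first by case: PP => _ _ _; apply; case: JS.
      by rewrite openC; apply: (partition_bigcup_closed PP); case: JS.
    by move=> [/continuous_Re].
  - by move=> x; rewrite in_itv indicE /=; case: (_ \in _); rewrite ?lexx ?ler01.
  by exists i => _ x; rewrite iE.
pose S : set cube := closure (range eval) `&`
  [set y | exists2 J, small J & y (chi J) = 1].
have SE x : S (eval x).
  split; first by apply: subset_closure; exists x.
  case: PP => _ _ P3 _; have [A PA Ax] := P3 x.
  have AS : small [set A].
    split=> [_ ->//|]; apply: card_le_trans (countable1 A) _.
    exact/infiniteP.
  exists [set A] => //; rewrite /eval (chiP _ AS) bigcup_set1 indicE mem_set //.
pose Y : topologicalType := set_type S.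
pose e x : Y := SigSub (mem_set (SE x)).
pose coord (i : unit_type) (y : Y) : R := (set_val y : cube) i.
have coordC i : continuous (coord i).
  move=> y.
  apply: (@continuous_comp Y cube R (@set_val cube S) (fun z : cube => z i)).
    exact: initial_continuous.
  exact: coord_continuous.
have dE : dense_embedding e.
  split.
  - by move=> x x' /(congr1 val) /= /eval_inj; apply; rewrite inE.
  - move=> U; rewrite eval_open; split.
      move=> [V oV <-]; exists ((@set_val cube S) @^-1` V) => //.
      by exists V.
    by move=> [_ [V oV <-] <-]; exists V.
  - move=> G [y Gy] [V oV VG]; move: Gy; rewrite -VG => Vy.
    have [cly _] : S (set_val y) by exact: set_valP.
    have [_ [[x _ <-] Vx]] := cly V (open_nbhs_nbhs (conj oV Vy)).
    by exists (e x); split=> //; exists x.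
have dC (T : set Y) : closed T -> (forall x, T (e x)) -> forall y, T y.
  by case: dE => _ _; exact: dense_closed_range.
exists Y, e, (fun J => [set y : Y | coord (chi J) y = 1]); split=> //.
- exact: hausdorff_set_type.
- move=> J JS.
  have lvl (r : R) : closed [set y | coord (chi J) y = r].
    apply: (@closed_comp _ _ (coord (chi J)) [set r]).
      by move=> y _; exact: coordC.
    exact/hausdorff_closed_set1/Rhausdorff.
  split.
  (* The coordinate is 0 or 1 on [X], hence on [Y] by density, so level 1 is the complement of the
     closed level 0. *)
  + have -> : [set y : Y | coord (chi J) y = 1] = ~` [set y | coord (chi J) y = 0].
      apply/seteqP; split=> y /=; first by move=> -> /eqP; rewrite oner_eq0.
      have : ([set y | coord (chi J) y = 0] `|` [set y | coord (chi J) y = 1]) y.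
        move: y; apply: dC => [|x]; first by apply: closedU; exact: lvl.
        rewrite /= /coord set_valE /= /eval (chiP _ JS) indicE.
        by case: (_ \in _); [right|left].
      by case.
    by rewrite openC; exact: lvl.
  (* [T] is closed in the compact unit cube, and it lies inside [S] because [J] itself is the
     required witness. *)
  + pose T : set cube := closure (range eval) `&` [set y | y (chi J) = 1].
    have -> : [set y : Y | coord (chi J) y = 1] = (@set_val cube S) @^-1` T.
      apply/seteqP; split=> y; last by case.
      by move=> y1; split=> //; have [] : S (set_val y) by exact: set_valP.
    apply: compact_set_type; first by move=> y [cly y1]; split=> //; exists J.
    apply: subclosed_compact cube_compact _.
      apply: closedI; first exact: closed_closure.
      apply: (@closed_comp _ _ (fun y : cube => y (chi J)) [set 1]).
        by move=> y _; exact: coord_continuous.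
      exact/hausdorff_closed_set1/Rhausdorff.
    have /closure_id -> : closed [set y : cube | forall i, y i \in `[0, 1]].
      exact: compact_closed.
    move=> y [+ _]; apply: closureS => _ [x _ <-] i.
    by have [_] := set_valP i; apply.
  + move=> x; rewrite /= /coord set_valE /= /eval (chiP _ JS) indicE.
    case: (boolP (_ \in _)) => [/set_mem//|/negP nx]; split=> [/eqP|/mem_set //].
    by rewrite eq_sym oner_eq0.
- by move=> y; have [_ [J JS y1]] : S (set_val y) := set_valP y; exists J.
- move=> f fB; have [fc [M fM]] := fB.
  (* The added 1 makes [N] positive even if [M] is 0, so that [-N, N] can be rescaled to the unit
     interval. *)
  pose N := `|M| + 1; have N0 : 0 < N by rewrite ltr_wpDl.
  have N20 : 0 < N *+ 2 by rewrite pmulrn_lgt0.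
  have fN x : Normc.normc (f x) <= N.
    by rewrite (le_trans (fM x)) // (le_trans (ler_norm _)) // lerDl.
  have scaled (u : X -> R) : continuous u -> (forall x, `|u x| <= N) ->
      exists i : unit_type, forall x, u x = coord i (e x) * (N *+ 2) - N.
    move=> uc uN.
    have [||i iE] := @unit_of (fun x => (u x + N) / (N *+ 2)).
    - move=> x; apply: (@cvgM R); last exact: cvg_cst.
      by apply: (@cvgD R R^o); [exact: uc|exact: cvg_cst].
    - move=> x; have := uN x; rewrite ler_norml => /andP[Nu uN'].
      rewrite in_itv /=; apply/andP; split.
        by rewrite divr_ge0 ?(ltW N20) // -lerBlDr sub0r.
      by rewrite ler_pdivrMr // mul1r mulr2n lerD2r.
    exists i => x; rewrite /coord set_valE /= /eval iE divfK ?addrK //.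
    by rewrite gt_eqF.
  have [||i iE] := scaled (fun x => complex.Re (f x)).
  - exact: continuous_Re.
  - by move=> x; exact: le_trans (Re_normc_le _) (fN x).
  have [||j jE] := scaled (fun x => complex.Im (f x)).
  - exact: continuous_Im.
  - by move=> x; exact: le_trans (Im_normc_le _) (fN x).
  pose g (y : Y) : R[i]^o :=
    ((coord i y * (N *+ 2) - N) +i* (coord j y * (N *+ 2) - N))%C.
  have gE x : g (e x) = f x by rewrite /g -iE -jE; case: (f x).
  have gc : continuous g.
    have aff k : continuous (fun y => coord k y * (N *+ 2) - N).
      move=> y; apply: (@cvgD R R^o Y (nbhs y) _ (fun z => coord k z * (N *+ 2))).
        apply: (@cvgM R Y (nbhs y) _ (coord k) (cst (N *+ 2))); first exact: coordC.
        exact: cst_continuous.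
      exact: (@cst_continuous Y R (- N)).
    by apply: continuous_complex; exact: aff.
  exists g; last by apply/funext => x; exact: gE.
  split=> //; exists M; apply: dC => [|x]; first exact: closed_normc_le.
  by have := fM x; rewrite -gE.
Qed.

End Compactification.

(** * The chain of ideals *)

Theorem theorem3p3p19 (R : realType) (X : topologicalType)
    (X_nonlindelof : ~ lindelof [set: X])
    (X_loclindelof : locally_lindelof X)
    (X_paracompact : paracompact X)
    (d : Order.disp_t) (L : tbOrderType d)
    (L_wo : wochoice.well_order (<=%O : rel L))
    (aleph : L -> Type)
    (aleph_seq : is_aleph_sequence aleph)
    (aleph_lambda : is_lindelof_number X (aleph \top%O)) :
  exists H : L -> set (X -> R[i]^o),
    [/\ forall mu : L, closed_ideal (H mu),
        C0 R X `<` H \bot%O,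
        forall mu kappa : L, (mu < kappa)%O -> H mu `<` H kappa,
        H \top%O = CB R X
      & forall mu : L, (mu < \top)%O ->
          exists Y : topologicalType,
            [/\ hausdorff_space Y /\ locally_compact [set: Y],
                countably_compact Y,
                exists e : X -> Y, dense_embedding e,
                isometrically_isomorphic (H mu) (C0 R Y)
              & C0 R Y = C00 R Y]].
Proof.
have [P PP] := clopen_lindelof_partition_exists X_paracompact X_loclindelof.
have [P1 P2 P3 P4] := PP.
have infP := partition_infinite PP X_nonlindelof.
have Ptop := partition_card_eq PP X_nonlindelof aleph_lambda.
have inf_aleph mu : infinite_set [set: aleph mu] by case: (aleph_seq mu) => -[].
have aleph_lt mu nu : (mu < nu)%O ->
    [set: aleph mu] #<= [set: aleph nu] /\ ~ ([set: aleph nu] #<= [set: aleph mu]).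
  by move=> munu; have [[_ /(_ mu munu)]] := aleph_seq nu.
have aleph_le mu nu : (mu <= nu)%O -> [set: aleph mu] #<= [set: aleph nu].
  by rewrite le_eqVlt => /predU1P[->|/aleph_lt[]//]; exact: card_lexx.
have [x0 _] : [set: X] !=set0.
  have [A /P1[[x Ax] _]] := infinite_setN0 infP.
  by exists x.
pose H mu : set (X -> R[i]^o) := small_support_ideal P (aleph mu).
pose chi (J : set (set X)) (x : X) : R[i] := (\1_(\bigcup_(A in J) A) x : R)%:C%C.
have chiB J : J `<=` P -> CB R X (chi J).
  move=> JP; apply: CB_indicator; first exact: P4.
  by rewrite openC; exact: (partition_bigcup_closed PP).
have chi1 J A x : J A -> A x -> chi J x = 1.
  by move=> JA Ax; rewrite /chi indicE mem_set //; exists A.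
have chi_ge J A x : J A -> A x -> 1%:R^-1 <= Normc.normc (chi J x).
  by move=> JA Ax; rewrite (chi1 J A) // Normc.normc1 invr1.
have chi_neq0 J A x : J A -> A x -> chi J x != 0.
  by move=> JA Ax; rewrite (chi1 J A) // oner_eq0.
have chiH mu J : J `<=` P -> J #<= [set: aleph mu] -> H mu (chi J).
  move=> JP Jmu; split; first exact: chiB.
  exists J => // x; rewrite /= /chi indicE.
  by case: (boolP (_ \in _)) => [/set_mem//|_]; rewrite eqxx.
(* Finitely many pieces cover [S], and by disjointness no other piece meets it. *)
have compact_finite (S : set X) : compact S -> finite_set [set A | P A /\ A `&` S !=set0].
  move=> cS; have [|x _|D DP SD] := @compact_finite_subset_cover X S _ P id cS.
  - exact: partition_open.
  - exact: P3.
  apply: sub_finite_set (finite_fset D) => A [PA [x [Ax /SD[B DB Bx]]]].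
  by rewrite (P2 A B) //; [have := DP _ DB; rewrite inE|exists x].
have countable_small mu (J : set (set X)) : countable J -> J #<= [set: aleph mu].
  by move=> cJ; apply: card_le_trans cJ _; exact/infiniteP.
exists H; split.
- by move=> mu; exact: small_support_closed_ideal.
- split.
    move=> f [fB fC]; split=> //.
    (* Each level set is compact and so meets finitely many pieces; hence countably many pieces
       carry [f]. *)
    pose J n := [set A | P A /\ A `&` [set x | n.+1%:R^-1 <= Normc.normc (f x)] !=set0].
    exists (\bigcup_n J n).
      split; first by apply: bigcup_sub => n _ A [].
      apply/countable_small/bigcup_countable => // n _.
      exact/finite_set_countable/compact_finite/fC.
    move=> x /=; rewrite -normc_gt0 => /exists_invS_le[n fn].
    have [A PA Ax] := P3 x; exists A => //.
    by exists n => //; split=> //; exists x.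
  (* Strictness: the indicator of the union of a countably infinite family of pieces has a level set
     meeting infinitely many pieces, so it is not in [C0]. *)
  move=> HC0; have /infiniteP := infP.
  move=> /(@card_le_funP _ (set X))[J0 J0P J0I].
  pose J := range J0.
  have JP : J `<=` P by move=> _ [n _ <-]; exact: J0P.
  have [_ /(_ 1%N isT)/compact_finite] : C0 R X (chi J).
    apply/HC0/chiH => //; apply: countable_small; exact: card_image_le.
  apply: (@sub_infinite_set _ J).
    move=> A JA; have [[x Ax] _] := P1 A (JP A JA); split; first exact: JP.
    by exists x; split=> //; exact: (chi_ge J A).
  by apply/infiniteP; have /card_eqPle[] : J #= [set: nat] by exact: inj_card_eq.
- move=> mu kappa mukappa; split.
    move=> f [fB [J [JP Jmu] fJ]]; split=> //; exists J => //; split=> //.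
    exact: card_le_trans Jmu (aleph_lt _ _ mukappa).1.
  (* Choose a family [J] of exactly [aleph kappa] pieces. If its indicator were in [H mu], then [J]
     would be contained in a family of size at most [aleph mu]. *)
  move=> Hkm; have : [set: aleph kappa] #<= P.
    apply: card_le_trans (aleph_le _ _ (lex1 kappa)) _.
    by have /card_eqPle[] := Ptop.
  move=> /(@card_le_funP _ (set X))[J0 J0P J0I].
  pose J := range J0.
  have JP : J `<=` P by move=> _ [n _ <-]; exact: J0P.
  have [_ [J' [J'P J'mu] JJ']] : H mu (chi J).
    by apply/Hkm/chiH => //; exact: card_image_le.
  apply: (aleph_lt _ _ mukappa).2.
  have /card_eqPle[_ /card_le_trans] : J #= [set: aleph kappa] by exact: inj_card_eq.
  apply; apply: card_le_trans J'mu; apply: subset_card_le => A JA.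
  have [[x Ax] _] := P1 A (JP A JA).
  have [|B J'B Bx] := JJ' x; first exact: (chi_neq0 J A).
  by rewrite (P2 A B) //; [exact: JP|exact: J'P|exists x].
- apply/seteqP; split=> f; first by case.
  (* At the top the whole partition is a small family, its cardinality being that of
     [aleph \top]. *)
  move=> fB; split=> //; exists P.
    by split=> //; have /card_eqPle[] := Ptop.
  by move=> x _; have [A PA Ax] := P3 x; exists A.
move=> mu _.
have [Y [e [B [eD YT2 Bprop Bcov ext]]]] :=
  @block_space_exists R X P (aleph mu) (inf_aleph mu) X_paracompact PP.
have Bop J (JS : small_family P (aleph mu) J) : open (B J) by case: (Bprop J JS).
have Bco J (JS : small_family P (aleph mu) J) : compact (B J) by case: (Bprop J JS).
have Btr J x (JS : small_family P (aleph mu) J) :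
    B J (e x) <-> (\bigcup_(A in J) A) x by case: (Bprop J JS).
exists Y; split.
- split=> //; exact: (block_locally_compact YT2 Bop Bco Bcov).
- exact: (block_countably_compact (inf_aleph mu) x0 eD YT2 Bop Bco Bcov Btr).
- by exists e.
- exact: (block_isometrically_isomorphic (inf_aleph mu) x0 eD YT2 Bop Bco Bcov Btr ext).
- exact: (block_C0_eq_C00 R (inf_aleph mu) eD YT2 Bop Bco Bcov Btr).
Qed.
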